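(* Let $X$ be a set and $a,b\in\mathcal{IP}_X$. Then $a\leq b$ in the natural order of the inverse semigroup $\mathcal{IP}_X$ if and only if $\equiv_a\,\supseteq\,\equiv_b$ (as relations on $X\cup X'$).
   Context: Let $X$ be an arbitrary set and let $X'=\{x':x\in X\}$ be a disjoint copy of $X$, with $x\mapsto x'$ a fixed bijection $X\to X'$; the inverse bijection is also denoted by $'$. Let $\mathcal{CS}_X$ be the set of all partitions of $X\cup X'$ into nonempty blocks. For $a\in\mathcal{CS}_X$ write $x\equiv_a y$ if $x,y\in X\cup X'$ lie in the same block of $a$. The product $ab$ of $a,b\in\mathcal{CS}_X$ is the partition corresponding to the equivalence relation $\equiv$ on $X\cup X'$ defined, for $x,y\in X$, by: (i) $x\equiv y$ iff $x\equiv_a y$ or there are $s\ge 1$ and $c_1,\dots,c_{2s}\in X$ with $x\equiv_a c_1'$, $c_1\equiv_b c_2$, $c_2'\equiv_a c_3'$, $\dots$, $c_{2s-1}\equiv_b c_{2s}$, $c_{2s}'\equiv_a y$; (ii) $x'\equiv y'$ iff $x'\equiv_b y'$ or there are $s\ge 1$ and $c_1,\dots,c_{2s}\in X$ with $x'\equiv_b c_1$, $c_1'\equiv_a c_2'$, $c_2\equiv_b c_3$, $\dots$, $c_{2s-1}'\equiv_a c_{2s}'$, $c_{2s}\equiv_b y'$; (iii) $x\equiv y'$ iff $y'\equiv x$ iff there are $s\ge 1$ and $c_1,\dots,c_{2s-1}\in X$ with $x\equiv_a c_1'$, $c_1\equiv_b c_2$, $c_2'\equiv_a c_3'$, $\dots$,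 $c_{2s-2}'\equiv_a c_{2s-1}'$, $c_{2s-1}\equiv_b y'$. With this product $\mathcal{CS}_X$ is a semigroup, and $\mathcal{IP}_X$ is the subsemigroup (an inverse semigroup) of all $a\in\mathcal{CS}_X$ each of whose blocks meets both $X$ and $X'$. The natural order on an inverse semigroup $S$: $a\le b$ iff there is an idempotent $e\in S$ with $a=be$. *)

(* Defs.v *)
From HB Require Import structures.
From mathcomp Require Import all_boot.
From mathcomp Require Import boolp classical_sets.
From Stdlib Require Import Relations.

Set Implicit Arguments.
Unset Strict Implicit.
Unset Printing Implicit Defensive.

Local Open Scope classical_set_scope.

HB.mixin Record Semigroup_isInverse S of Semigroup S := {
  inverse_unique : forall a : S,
    exists! b : S, (a * b * a)%g = a /\ (b * a * b)%g = b
}.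

#[short(type="inverseSemigroupType")]
HB.structure Definition InverseSemigroup :=
  { S of Semigroup_isInverse S & Semigroup S }.

Definition natural_le (S : inverseSemigroupType) (a b : S) : Prop :=
  exists e : S, (e * e)%g = e /\ a = (b * e)%g.

(* The disjoint union of [X] and its copy [X'] is the sum type [X + X]: [inl x]
   stands for [x] and [inr x] for [x']. *)
Record CS (X : Type) := MkCS {
  blocks : set (set (X + X));
  blocksP : partition blocks id setT
}.

Definition cs_rel (X : Type) (a : CS X) (u v : X + X) : Prop :=
  exists2 B, blocks a B & B u /\ B v.

(* [chain p q c n] is [p c_1 c_2], [q c_2 c_3], [p c_3 c_4], ..., up to [c_n];
   only the values [c 1], ..., [c n] of [c] matter. *)
Definition chain (X : Type) (p q : X -> X -> Prop) (c : nat -> X) (n : nat) :=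
  forall i, 0 < i < n -> if odd i then p (c i) (c i.+1) else q (c i) (c i.+1).

Definition upper (X : Type) (r : X + X -> X + X -> Prop) (x y : X) : Prop :=
  r (inl x) (inl y).

Definition lower (X : Type) (r : X + X -> X + X -> Prop) (x y : X) : Prop :=
  r (inr x) (inr y).

Definition prod_cross (X : Type) (a b : X + X -> X + X -> Prop) (x y : X) :=
  exists (s : nat) (c : nat -> X),
    [/\ 1 <= s,
        a (inl x) (inr (c 1)),
        chain (upper b) (lower a) c (2 * s - 1) &
        b (inl (c (2 * s - 1))) (inr y)].

Definition prod_rel (X : Type) (a b : X + X -> X + X -> Prop) (u v : X + X) :
    Prop :=
  match u, v with
  | inl x, inl y =>
      a (inl x) (inl y) \/
      exists (s : nat) (c : nat -> X),
        [/\ 1 <= s,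
            a (inl x) (inr (c 1)),
            chain (upper b) (lower a) c (2 * s) &
            a (inr (c (2 * s))) (inl y)]
  | inr x, inr y =>
      b (inr x) (inr y) \/
      exists (s : nat) (c : nat -> X),
        [/\ 1 <= s,
            b (inr x) (inl (c 1)),
            chain (lower a) (upper b) c (2 * s) &
            b (inl (c (2 * s))) (inr y)]
  | inl x, inr y => prod_cross a b x y
  | inr y, inl x => prod_cross a b x y
  end.

Definition classes (T : Type) (r : T -> T -> Prop) : set (set T) :=
  [set B | exists u, B = [set v | r u v]].

Lemma classes_partition (T : Type) (r : T -> T -> Prop) :
  equivalence T r -> partition (classes r) id setT.
Proof.
move=> [rr rt rs]; split.
- apply/seteqP; split=> [//|u _]; exists [set v | r u v]; last exact: rr.
  by exists u.
- move=> _ _ [u ->] [v ->] [w [/= uw vw]]; apply/seteqP; split=> z /= h.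
    exact: rt vw (rt _ _ _ (rs _ _ uw) h).
  exact: rt uw (rt _ _ _ (rs _ _ vw) h).
- by move=> _ [u ->]; exists u; exact: rr.
Qed.

Definition cs_of (X : Type) (r : X + X -> X + X -> Prop)
    (er : equivalence _ r) : CS X :=
  MkCS (classes_partition er).

Lemma cs_relE (X : Type) (r : X + X -> X + X -> Prop) (er : equivalence _ r)
    (u v : X + X) :
  cs_rel (cs_of er) u v <-> r u v.
Proof.
case: (er) => rr rt rs; split=> [[_ [w ->] [/= wu wv]]|uv].
  exact: rt (rs _ _ wu) wv.
by exists [set z | r u z]; [exists u | split=> //=; exact: rr].
Qed.

Lemma cs_rel_equivalence (X : Type) (a : CS X) : equivalence _ (cs_rel a).
Proof.
case: a => bl [cov tr ne]; rewrite /cs_rel /=; split.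
- move=> u; have : cover bl id u by rewrite cov.
  by case=> B blB Bu; exists B.
- move=> u v w [B blB [Bu Bv]] [C blC [Cv Cw]].
  have BC : B = C by apply: tr => //; exists v.
  by exists B => //; split=> //; rewrite BC.
- by move=> u v [B blB [Bu Bv]]; exists B.
Qed.

Lemma cs_rel_block (X : Type) (a : CS X) (B : set (X + X)) (u : X + X) :
  blocks a B -> B u -> B = [set v | cs_rel a u v].
Proof.
case: a => bl [cov tr ne] /= blB Bu; apply/seteqP; split=> v /=.
  by move=> Bv; exists B.
move=> [C /= blC [Cu Cv]]; suff -> : B = C by [].
by apply: tr => //; exists u.
Qed.

Lemma cs_ext (X : Type) (a b : CS X) :
  (forall u v, cs_rel a u v <-> cs_rel b u v) -> a = b.
Proof.
move=> h; suff e : blocks a = blocks b.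
  by move: a b e {h} => [A PA] [B PB] /= e; subst B; congr MkCS; exact: Prop_irrelevance.
have aux (c d : CS X) : (forall u v, cs_rel c u v <-> cs_rel d u v) ->
    blocks c `<=` blocks d.
  move=> {}h B cB; have [_ _ ne] := blocksP c.
  have [u /= Bu] := ne _ cB; rewrite (cs_rel_block cB Bu).
  have [C dC [Cu _]] : cs_rel d u u by case: (cs_rel_equivalence d).
  suff -> : [set v | cs_rel c u v] = C by [].
  by rewrite (cs_rel_block dC Cu); apply/seteqP; split=> v /=; apply h.
by apply/seteqP; split; apply: aux => // u v; split=> ?; apply/h.
Qed.

Section Product.
Variable X : Type.
Implicit Types (a b : X + X -> X + X -> Prop).

Lemma chain_catP (p q : X -> X -> Prop) (c : nat -> X) (n : nat) (d : X) :
  chain p q c n -> (if odd n then p (c n) d else q (c n) d) ->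
  chain p q (fun i => if i == n.+1 then d else c i) n.+1.
Proof.
move=> ch l i /andP[i0]; rewrite ltnS leq_eqVlt => /orP[/eqP ->|lt].
  by rewrite eqxx (ltn_eqF (ltnSn n)).
rewrite (ltn_eqF (leqW lt)) eqSS (ltn_eqF lt).
by apply: ch; rewrite i0.
Qed.

(* [reach p q x0 k d]: [d] ends a chain whose length has the parity [k]. *)
Inductive reach (p q : X -> X -> Prop) (st : X -> Prop) : bool -> X -> Prop :=
| reach1 c : st c -> reach p q st true c
| reachP c d : reach p q st true c -> p c d -> reach p q st false d
| reachQ c d : reach p q st false c -> q c d -> reach p q st true d.

Lemma reachE p q (st : X -> Prop) k d :
  reach p q st k d <->
  exists (n : nat) (c : nat -> X),
    [/\ 0 < n, odd n = k, st (c 1), chain p q c n & c n = d].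
Proof.
split.
- elim=> {k d} [c sc|c d _ [n [f [n0 on s1 ch <-]]] pcd
              |c d _ [n [f [n0 on s1 ch <-]]] pcd].
  + by exists 1, (fun=> c); split=> // i; case: i => [|[|]].
  + exists n.+1, (fun i => if i == n.+1 then d else f i).
    rewrite /= on eqSS (ltn_eqF n0) eqxx; split=> //.
    by apply: chain_catP => //; rewrite on.
  + exists n.+1, (fun i => if i == n.+1 then d else f i).
    rewrite /= on eqSS (ltn_eqF n0) eqxx; split=> //.
    by apply: chain_catP => //; rewrite on.
- case=> n [c [n0 <- s1 ch <-]]; elim: n n0 ch => // -[|n] IH _ ch.
    exact: reach1.
  have {}IH : reach p q st (odd n.+1) (c n.+1).
    apply: IH => // i /andP[i0 lt]; apply: ch.
    by rewrite i0 ltnS ltnW.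
  have := ch n.+1; rewrite !ltnSn => /(_ isT).
  rewrite [odd n.+2]/=.
  move: IH; rewrite /=; case: (odd n) => /=; last exact: reachP.
  exact: reachQ.
Qed.

Lemma reach_evenE p q (st : X -> Prop) (en : X -> Prop) :
  (exists (s : nat) (c : nat -> X),
    [/\ 1 <= s, st (c 1), chain p q c (2 * s) & en (c (2 * s))]) <->
  exists2 d, reach p q st false d & en d.
Proof.
split=> [[s [c [s0 s1 ch e]]]|[d /reachE[n [c [n0 on s1 ch <-]]] e]].
  exists (c (2 * s)) => //; apply/reachE; exists (2 * s), c.
  by rewrite oddM muln_gt0 s0.
have en2 : n = 2 * n./2 by rewrite mul2n -[LHS]odd_double_half on.
exists n./2, c; rewrite -en2; split=> //.
by move: n0; rewrite {1}en2 muln_gt0.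
Qed.

Lemma reach_oddE p q (st : X -> Prop) (en : X -> Prop) :
  (exists (s : nat) (c : nat -> X),
    [/\ 1 <= s, st (c 1), chain p q c (2 * s - 1) & en (c (2 * s - 1))]) <->
  exists2 d, reach p q st true d & en d.
Proof.
split=> [[s [c [s0 s1 ch e]]]|[d /reachE[n [c [n0 on s1 ch <-]]] e]].
  exists (c (2 * s - 1)) => //; apply/reachE; exists (2 * s - 1), c.
  split=> //; case: s s0 {s1 ch e} => // s _; rewrite mul2n doubleS subn1 //=.
  by rewrite odd_double.
have en2 : n = 2 * (n./2).+1 - 1.
  by rewrite mul2n doubleS subn1 /= -[LHS]odd_double_half on.
by exists (n./2).+1, c; rewrite -en2.
Qed.

Lemma prod_crossE a b x y :
  prod_cross a b x y <->
  exists2 d, reach (upper b) (lower a) (fun c => a (inl x) (inr c)) true d &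
             b (inl d) (inr y).
Proof. exact: (reach_oddE _ _ _ (fun d => b (inl d) (inr y))). Qed.

Lemma prod_upperE a b x y :
  prod_rel a b (inl x) (inl y) <->
  a (inl x) (inl y) \/
  exists2 d, reach (upper b) (lower a) (fun c => a (inl x) (inr c)) false d &
             a (inr d) (inl y).
Proof.
by rewrite -(reach_evenE _ _ _ (fun d => a (inr d) (inl y))).
Qed.

Definition sw (u : X + X) : X + X :=
  match u with inl x => inr x | inr x => inl x end.

Lemma swK u : sw (sw u) = u. Proof. by case: u. Qed.

Definition flip a : X + X -> X + X -> Prop := fun u v => a (sw u) (sw v).

Lemma flipK a : flip (flip a) = a.
Proof. by apply/funext => u; apply/funext => v; rewrite /flip !swK. Qed.

Lemma flip_equivalence a : equivalence _ a -> equivalence _ (flip a).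
Proof.
move=> [ar att ars]; split=> [u|u v w|u v]; first exact: ar.
  exact: att.
exact: ars.
Qed.

(* Layers 0, 1, 2 (resp. 0, 1, 2, 3): the relation at position [i] of the list
   joins points of layers [i] and [i+1]. *)
Definition emb (i j : nat) (u : X + X) : nat * X :=
  match u with inl x => (i, x) | inr x => (j, x) end.

Inductive conn2 a b : nat * X -> nat * X -> Prop :=
| conn2_refl n : conn2 a b n n
| conn2_a n u v : conn2 a b n (emb 0 1 u) -> a u v -> conn2 a b n (emb 0 1 v)
| conn2_b n u v : conn2 a b n (emb 1 2 u) -> b u v -> conn2 a b n (emb 1 2 v).

Inductive conn3 a b (c : X + X -> X + X -> Prop) : nat * X -> nat * X -> Prop :=
| conn3_refl n : conn3 a b c n n
| conn3_a n u v :
    conn3 a b c n (emb 0 1 u) -> a u v -> conn3 a b c n (emb 0 1 v)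
| conn3_b n u v :
    conn3 a b c n (emb 1 2 u) -> b u v -> conn3 a b c n (emb 1 2 v)
| conn3_c n u v :
    conn3 a b c n (emb 2 3 u) -> c u v -> conn3 a b c n (emb 2 3 v).

Lemma conn2_trans a b n m k : conn2 a b n m -> conn2 a b m k -> conn2 a b n k.
Proof.
move=> nm mk; elim: mk nm => // {}m u v _ IH uv /IH h.
  exact: conn2_a h uv.
exact: conn2_b h uv.
Qed.

Lemma conn2_sym a b : equivalence _ a -> equivalence _ b ->
  forall n m, conn2 a b n m -> conn2 a b m n.
Proof.
move=> [_ _ sa] [_ _ sb] n m; elim=> {n m} [n|n u v _ IH uv|n u v _ IH uv].
- exact: conn2_refl.
- apply: conn2_trans IH; apply: (@conn2_a _ _ _ v) (sa _ _ uv).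
  exact: conn2_refl.
- apply: conn2_trans IH; apply: (@conn2_b _ _ _ v) (sb _ _ uv).
  exact: conn2_refl.
Qed.

Definition mirror (k : nat) (n : nat * X) : nat * X := (k - n.1, n.2).

Lemma conn2_mirror a b n m :
  conn2 a b n m -> conn2 (flip b) (flip a) (mirror 2 n) (mirror 2 m).
Proof.
elim=> {n m} [n|n u v _ IH uv|n u v _ IH uv]; first exact: conn2_refl.
- have e w : mirror 2 (emb 0 1 w) = emb 1 2 (sw w) by case: w.
  by move: IH; rewrite !e => /conn2_b; apply; rewrite /flip !swK.
- have e w : mirror 2 (emb 1 2 w) = emb 0 1 (sw w) by case: w.
  by move: IH; rewrite !e => /conn2_a; apply; rewrite /flip !swK.
Qed.

Lemma conn3_mirror a b (c : X + X -> X + X -> Prop) n m :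
  conn3 a b c n m ->
  conn3 (flip c) (flip b) (flip a) (mirror 3 n) (mirror 3 m).
Proof.
elim=> {n m} [n|n u v _ IH uv|n u v _ IH uv|n u v _ IH uv].
- exact: conn3_refl.
- have e w : mirror 3 (emb 0 1 w) = emb 2 3 (sw w) by case: w.
  by move: IH; rewrite !e => /conn3_c; apply; rewrite /flip !swK.
- have e w : mirror 3 (emb 1 2 w) = emb 1 2 (sw w) by case: w.
  by move: IH; rewrite !e => /conn3_b; apply; rewrite /flip !swK.
- have e w : mirror 3 (emb 2 3 w) = emb 0 1 (sw w) by case: w.
  by move: IH; rewrite !e => /conn3_a; apply; rewrite /flip !swK.
Qed.

Lemma conn2_reach a b x k d :
  reach (upper b) (lower a) (fun c => a (inl x) (inr c)) k d ->
  conn2 a b (0, x) (1, d).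
Proof.
elim=> {k d} [c xc|c d _ IH cd|c d _ IH cd].
- by apply: (@conn2_a _ _ _ (inl x) (inr c)) xc; exact: conn2_refl.
- exact: (@conn2_b _ _ _ (inl c) (inl d)) IH cd.
- exact: (@conn2_a _ _ _ (inr c) (inr d)) IH cd.
Qed.

Lemma prod_conn2_top a b : equivalence _ a -> equivalence _ b ->
  forall x v, prod_rel a b (inl x) v <-> conn2 a b (0, x) (emb 0 2 v).
Proof.
move=> [ra ta sa] [rb tb sb] x; set st := fun c => a (inl x) (inr c).
set R := reach (upper b) (lower a) st.
have RD c : R true c -> R false c by move=> h; apply: reachP h (rb _).
have RA c d : R false c -> lower a c d -> R false d.
  by move=> h cd; apply: RD; exact: reachQ h cd.
have RB c v : R false c -> b (inl c) v -> exists2 e, R true e & b (inl e) v.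
  move=> h; inversion_clear h as [|e ? Re ec|] => cv.
  by exists e => //; exact: tb ec cv.
have inv n m : conn2 a b n m -> n = (0, x) ->
  match m.1 with
  | 0 => prod_rel a b (inl x) (inl m.2)
  | 1 => R false m.2
  | _ => prod_rel a b (inl x) (inr m.2)
  end.
  elim=> {n m} [n -> /=|n u v _ IH uv /IH {}IH|n u v _ IH uv /IH {}IH].
  - by left; exact: ra.
  - case: u v uv IH => y [z|z] yz /=.
    + move=> /prod_upperE h; apply/prod_upperE; case: h => [h|[d Rd dy]].
        by left; exact: ta h yz.
      by right; exists d => //; exact: ta dy yz.
    + move=> /prod_upperE [h|[d Rd dy]].
        by apply: RD; apply: reach1; exact: ta h yz.
      by apply: RA Rd _; exact: ta dy yz.
    + by move=> Ry; apply/prod_upperE; right; exists y.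
    + by move=> Ry; exact: RA Ry yz.
  - case: u v uv IH => y [z|z] yz /=.
    + move=> /RB /(_ yz)[e Re ez]; exact: reachP Re ez.
    + by move=> /RB /(_ yz)[e Re ez]; apply/prod_crossE; exists e.
    + move=> /prod_crossE[d Rd dy]; apply: reachP Rd _; exact: tb dy yz.
    + move=> /prod_crossE[d Rd dy]; apply/prod_crossE; exists d => //.
      exact: tb dy yz.
split; last by move=> /inv /(_ erefl); case: v.
case: v => y.
- move=> /prod_upperE [h|[d /conn2_reach h dy]].
    by apply: (@conn2_a _ _ _ (inl x) (inl y)) h; exact: conn2_refl.
  exact: (@conn2_a _ _ _ (inr d) (inl y)) h dy.
- move=> /prod_crossE [d /conn2_reach h dy].
  exact: (@conn2_b _ _ _ (inl d) (inr y)) h dy.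
Qed.

Lemma prod_conn2 a b : equivalence _ a -> equivalence _ b ->
  forall u v, prod_rel a b u v <-> conn2 a b (emb 0 2 u) (emb 0 2 v).
Proof.
move=> ea eb [x|x] v; first exact: prod_conn2_top.
have cs := conn2_sym ea eb.
case: v => y.
  have -> : prod_rel a b (inr x) (inl y) = prod_rel a b (inl y) (inr x) by [].
  by split=> [/(prod_conn2_top ea eb)/cs //|/cs h]; apply/prod_conn2_top.
have -> : prod_rel a b (inr x) (inr y) =
          prod_rel (flip b) (flip a) (inl x) (inl y) by [].
rewrite (prod_conn2_top (flip_equivalence eb) (flip_equivalence ea)) /=.
split=> /conn2_mirror //.
by rewrite !flipK.
Qed.

Lemma prod_equivalence a b : equivalence _ a -> equivalence _ b ->
  equivalence _ (prod_rel a b).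
Proof.
move=> ea eb; have P := prod_conn2 ea eb; split=> [u|u v w|u v].
- by apply/P; exact: conn2_refl.
- by move=> /P uv /P vw; apply/P; exact: conn2_trans uv vw.
- by move=> /P uv; apply/P; exact: conn2_sym.
Qed.

Lemma prod_flip a b : equivalence _ a -> equivalence _ b ->
  prod_rel (flip b) (flip a) = flip (prod_rel a b).
Proof.
move=> ea eb; apply/funext => u; apply/funext => v; apply/propext.
rewrite /flip (prod_conn2 ea eb).
rewrite (prod_conn2 (flip_equivalence eb) (flip_equivalence ea)).
have e w : emb 0 2 w = mirror 2 (emb 0 2 (sw w)) by case: w.
have f w : emb 0 2 (sw w) = mirror 2 (emb 0 2 w) by case: w.
split=> /conn2_mirror; first by rewrite !flipK !f.
by rewrite -!e.
Qed.

Lemma prodA_conn3 a b (c : X + X -> X + X -> Prop) :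
  equivalence _ a -> equivalence _ b -> equivalence _ c ->
  forall u v, prod_rel (prod_rel a b) c u v <->
              conn3 a b c (emb 0 3 u) (emb 0 3 v).
Proof.
move=> ea eb ec; have eab := prod_equivalence ea eb; case: (ec) => rc tc sc.
have P2 := prod_conn2 ea eb.
have tr n m k : conn3 a b c n m -> conn2 a b m k -> conn3 a b c n k.
  move=> h mk; elim: mk h => // {}m w z _ IH wz /IH h.
    exact: conn3_a h wz.
  exact: conn3_b h wz.
move=> u v; rewrite (prod_conn2 eab ec); split.
- pose f (n : nat * X) := (if n.1 == 0 then 0 else n.1.+1, n.2).
  have fe w : f (emb 0 2 w) = emb 0 3 w by case: w.
  rewrite -!fe; elim=> {u v} [n|n u v _ IH uv|n u v _ IH uv].
  + exact: conn3_refl.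
  + have e w : f (emb 0 1 w) = emb 0 2 w by case: w.
    by move: IH; rewrite !e => /tr; apply; apply/P2.
  + have e w : f (emb 1 2 w) = emb 2 3 w by case: w.
    by move: IH; rewrite !e => /conn3_c; apply.
- pose C := conn2 (prod_rel a b) c (emb 0 2 u).
  pose Z m := exists2 z : X + X, C (emb 0 1 z) & conn2 a b (emb 0 2 z) m.
  have Z2 w : Z (emb 0 2 w) -> C (emb 0 1 w).
    by move=> [z Cz /P2 zw]; exact: conn2_a Cz zw.
  have inv n m : conn3 a b c n m -> n = emb 0 3 u ->
    if m.1 == 3 then C (2, m.2) else Z m.
    elim=> {n m} [n ->|n w z _ IH wz /IH {}IH|n w z _ IH wz /IH {}IH
                 |n w z _ IH wz /IH {}IH].
    + rewrite /Z /C; case: (u) => x /=; last exact: conn2_refl.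
      by exists (inl x); exact: conn2_refl.
    + have {IH}[t Ct tw] : Z (emb 0 1 w) by case: (w) IH.
      suff : Z (emb 0 1 z) by case: (z).
      by exists t => //; exact: conn2_a tw wz.
    + have {IH}[t Ct tw] : Z (emb 1 2 w) by case: (w) IH.
      suff : Z (emb 1 2 z) by case: (z).
      by exists t => //; exact: conn2_b tw wz.
    + have {}IH : C (emb 1 2 w).
        by case: w IH {wz} => x //= h; exact: (Z2 (inr x)) h.
      have {}IH : C (emb 1 2 z) by exact: conn2_b IH wz.
      case: z IH {wz} => x //= h.
      by exists (inr x) => //; exact: conn2_refl.
  move=> /inv /(_ erefl); case: (v) => x //= h.
  exact: (Z2 (inl x)) h.
Qed.

Lemma prodA a b (c : X + X -> X + X -> Prop) :
  equivalence _ a -> equivalence _ b -> equivalence _ c ->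
  prod_rel a (prod_rel b c) = prod_rel (prod_rel a b) c.
Proof.
move=> ea eb ec; have eF := flip_equivalence.
have ebc := prod_equivalence eb ec.
rewrite -[LHS]flipK -(prod_flip ea ebc) -(prod_flip eb ec).
apply/funext => u; apply/funext => v; apply/propext.
rewrite (prodA_conn3 ea eb ec) {1}/flip.
rewrite (prodA_conn3 (eF _ ec) (eF _ eb) (eF _ ea)).
have e w : emb 0 3 w = mirror 3 (emb 0 3 (sw w)) by case: w.
have f w : emb 0 3 (sw w) = mirror 3 (emb 0 3 w) by case: w.
split=> /conn3_mirror; first by rewrite !flipK -!e.
by rewrite -!f.
Qed.

End Product.

Definition cs_mul (X : Type) (a b : CS X) : CS X :=
  cs_of (prod_equivalence (cs_rel_equivalence a) (cs_rel_equivalence b)).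

Lemma cs_rel_mul (X : Type) (a b : CS X) :
  cs_rel (cs_mul a b) = prod_rel (cs_rel a) (cs_rel b).
Proof.
by apply/funext => u; apply/funext => v; apply/propext; exact: cs_relE.
Qed.

Lemma cs_mulA (X : Type) : associative (@cs_mul X).
Proof.
move=> a b c; apply: cs_ext => u v; rewrite !cs_rel_mul.
by rewrite prodA //; exact: cs_rel_equivalence.
Qed.

HB.instance Definition _ (X : Type) := gen_eqMixin (CS X).
HB.instance Definition _ (X : Type) := gen_choiceMixin (CS X).
HB.instance Definition _ (X : Type) := isSemigroup.Build (CS X) (@cs_mulA X).

Definition meets_both (X : Type) (a : CS X) : Prop :=
  forall B, blocks a B -> (exists x, B (inl x)) /\ (exists x, B (inr x)).

Record IP (X : Type) := MkIP {
  ip_val :> CS X;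
  ipP : meets_both ip_val
}.
Arguments ipP {X} _ _ _.

Lemma meets_bothE (X : Type) (a : CS X) :
  meets_both a <->
  (forall x, exists y, cs_rel a (inl x) (inr y)) /\
  (forall y, exists x, cs_rel a (inl x) (inr y)).
Proof.
have [ra _ sa] := cs_rel_equivalence a.
split=> [h|[h1 h2] B aB].
  split=> x.
    have [B aB [Bx _]] := ra (inl x); have [_ [y By]] := h _ aB.
    by exists y, B.
  have [B aB [Bx _]] := ra (inr x); have [[y By] _] := h _ aB.
  by exists y, B.
have [_ _ /(_ _ aB)[u /= Bu]] := blocksP a; rewrite (cs_rel_block aB Bu).
case: u {Bu} => x; split.
- by exists x; exact: ra.
- by have [y] := h1 x; exists y.
- by have [y] := h2 x; exists y; exact: sa.
- by exists x; exact: ra.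
Qed.

Lemma prod_cross1 (X : Type) (a b : X + X -> X + X -> Prop) x c y :
  a (inl x) (inr c) -> b (inl c) (inr y) -> prod_rel a b (inl x) (inr y).
Proof. by move=> xc cy; apply/prod_crossE; exists c => //; exact: reach1. Qed.

Lemma meets_both_mul (X : Type) (a b : CS X) :
  meets_both a -> meets_both b -> meets_both (a * b)%g.
Proof.
move=> /meets_bothE[a1 a2] /meets_bothE[b1 b2]; apply/meets_bothE.
rewrite cs_rel_mul; split=> x.
  have [c xc] := a1 x; have [y cy] := b1 c.
  by exists y; exact: prod_cross1 xc cy.
have [c cx] := b2 x; have [y yc] := a2 c.
by exists y; exact: prod_cross1 yc cx.
Qed.

Definition ip_mul (X : Type) (a b : IP X) : IP X :=
  MkIP (meets_both_mul (ipP a) (ipP b)).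

Lemma ip_inj (X : Type) (a b : IP X) : ip_val a = ip_val b -> a = b.
Proof.
case: a b => [a pa] [b pb] /= e; subst b; congr MkIP; exact: Prop_irrelevance.
Qed.

Lemma ip_mulA (X : Type) : associative (@ip_mul X).
Proof. by move=> a b c; apply: ip_inj; exact: cs_mulA. Qed.

HB.instance Definition _ (X : Type) := gen_eqMixin (IP X).
HB.instance Definition _ (X : Type) := gen_choiceMixin (IP X).
HB.instance Definition _ (X : Type) := isSemigroup.Build (IP X) (@ip_mulA X).

Lemma ip_rel_mul (X : Type) (a b : IP X) :
  cs_rel (a * b)%g = prod_rel (cs_rel a) (cs_rel b).
Proof. exact: cs_rel_mul. Qed.

Lemma ip_ext (X : Type) (a b : IP X) :
  (forall x y, cs_rel a (inl x) (inr y) <-> cs_rel b (inl x) (inr y)) -> a = b.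
Proof.
have aux (c d : IP X) :
    (forall x y, cs_rel c (inl x) (inr y) <-> cs_rel d (inl x) (inr y)) ->
    forall u v, cs_rel c u v -> cs_rel d u v.
  have [rc tc sc] := cs_rel_equivalence c.
  have [rd td sd] := cs_rel_equivalence d.
  have /meets_bothE[c1 c2] := ipP c.
  move=> h [x|x] [y|y] xy.
  - have [z yz] := c1 y.
    have /h xz := tc _ _ _ xy yz; move/h in yz.
    exact: td xz (sd _ _ yz).
  - exact/h.
  - by apply: sd; apply/h; exact: sc.
  - have [z zx] := c2 x.
    have /h zy := tc _ _ _ zx xy; move/h in zx.
    exact: td (sd _ _ zx) zy.
move=> h; apply/ip_inj/cs_ext => u v; split; apply: aux => // x y.
by split=> ?; apply/h.
Qed.

Lemma ip_idem (X : Type) (e : IP X) : (e * e)%g = e ->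
  forall x, cs_rel e (inl x) (inr x).
Proof.
move=> ee x; have [_ t s] := cs_rel_equivalence e.
have /meets_bothE[e1 e2] := ipP e.
have cr y z w : cs_rel e (inl y) (inr z) -> cs_rel e (inl z) (inr w) ->
    cs_rel e (inl y) (inr w).
  by rewrite -{3}ee ip_rel_mul; exact: prod_cross1.
have [z xz] := e1 x; have [w wx] := e2 x.
exact: t xz (t _ _ _ (s _ _ (cr _ _ _ wx xz)) wx).
Qed.

Lemma ip_inverse_cross (X : Type) (a b : IP X) :
  (a * b * a)%g = a -> (b * a * b)%g = b ->
  forall x y, cs_rel a (inl x) (inr y) -> cs_rel b (inl y) (inr x).
Proof.
move=> aba bab x y xy; have /meets_bothE[b1 _] := ipP b.
have ab2 : (a * b * (a * b))%g = (a * b)%g.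
  by rewrite mulgA aba.
have iab := ip_idem ab2.
have [_ t s] := cs_rel_equivalence (a * b)%g.
have [w yw] := b1 y.
have xw : cs_rel (a * b)%g (inl x) (inr w).
  by rewrite ip_rel_mul; exact: prod_cross1 xy yw.
have wx : cs_rel (a * b)%g (inl w) (inr x).
  exact: t (iab w) (t _ _ _ (s _ _ xw) (iab x)).
rewrite -bab -mulgA ip_rel_mul; exact: prod_cross1 yw wx.
Qed.

Lemma ip_inverse_ex (X : Type) (a : IP X) :
  exists b : IP X, (forall u v, cs_rel b u v <-> flip (cs_rel a) u v).
Proof.
have ef := flip_equivalence (cs_rel_equivalence a).
have /meets_bothE[a1 a2] := ipP a.
have [_ _ s] := cs_rel_equivalence a.
have mb : meets_both (cs_of ef).
  apply/meets_bothE; split=> x.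
    by have [y yx] := a2 x; exists y; apply/cs_relE; exact: s.
  by have [y yx] := a1 x; exists y; apply/cs_relE; exact: s.
by exists (MkIP mb) => u v; exact: cs_relE.
Qed.

Lemma ip_mulK (X : Type) (a b : IP X) :
  (forall u v, cs_rel b u v <-> flip (cs_rel a) u v) -> (a * b * a)%g = a.
Proof.
move=> h; have [r t s] := cs_rel_equivalence a.
have /meets_bothE[a1 a2] := ipP a.
have cab x y : cs_rel (a * b)%g (inl x) (inr y) <-> cs_rel a (inl x) (inl y).
  rewrite ip_rel_mul; split.
    move=> /prod_crossE[d Rd /h]; rewrite /flip /= => dy.
    suff xd : cs_rel a (inl x) (inr d) by exact: t xd dy.
    elim: Rd {dy} => {d} [c //|c d _ IH /h|c d _ IH cd].
      exact: t.
    exact: t IH cd.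
  move=> xy; have [c yc] := a1 y; apply: (@prod_cross1 _ _ _ x c y).
    exact: t xy yc.
  by apply/h; exact: s.
have lab x y : cs_rel (a * b)%g (inr x) (inr y) -> cs_rel a (inl x) (inl y).
  have [_ tt _] := cs_rel_equivalence (a * b)%g.
  by move=> xy; apply/cab; apply: tt xy; apply/cab; exact: r.
apply: ip_ext => x y; rewrite ip_rel_mul; split.
  move=> /prod_crossE[d Rd]; apply: (t).
  by elim: Rd => {d} [c /cab //|c d _ IH|c d _ IH /lab]; exact: t.
by apply: prod_cross1; apply/cab; exact: r.
Qed.

Lemma ip_inverse_unique (X : Type) (a : IP X) :
  exists! b : IP X, (a * b * a)%g = a /\ (b * a * b)%g = b.
Proof.
have [b hb] := ip_inverse_ex a.
have aba := ip_mulK hb.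
have bab : (b * a * b)%g = b.
  by apply: ip_mulK => u v; rewrite -{1}(swK u) -{1}(swK v); split=> /hb.
exists b; split=> // c [aca cac]; apply: ip_ext => x y; split=> xy.
  apply: (ip_inverse_cross aca cac); exact: (ip_inverse_cross bab aba).
apply: (ip_inverse_cross aba bab); exact: (ip_inverse_cross cac aca).
Qed.

HB.instance Definition _ (X : Type) :=
  Semigroup_isInverse.Build (IP X) (@ip_inverse_unique X).

(* Main.v *)
(* If [a = b * e] with [e] idempotent, then [e] joins every [y] to [y'], so any
   [x ~_b y'] gives [x ~_a y']; these cross pairs determine the relations.
   Conversely, let [e] join two points exactly when [a] joins their primed
   versions; then [e] is idempotent, and [b * e = a] as soon as [a] contains
   [b]. *)
Require Import Defs.
From mathcomp Require Import all_boot.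
From Stdlib Require Import Relations.

(** Every block of [b] meets both sides, so two points on one side that [b] joins are linked by two
    cross pairs through a point of the other side. *)
Lemma ip_sub_cross (X : Type) (a b : IP X) :
  (forall x y, cs_rel b (inl x) (inr y) -> cs_rel a (inl x) (inr y)) ->
  forall u v, cs_rel b u v -> cs_rel a u v.
Proof.
have [_ tb sb] := cs_rel_equivalence b.
have [_ ta sa] := cs_rel_equivalence a.
have /meets_bothE[b1 b2] := ipP b.
move=> h [x|x] [y|y] xy.
- have [z yz] := b1 y.
  exact: ta _ _ _ (h _ _ (tb _ _ _ xy yz)) (sa _ _ (h _ _ yz)).
- exact: h.
- by apply: sa; apply: h; exact: sb.
- have [z zx] := b2 x.
  exact: ta _ _ _ (sa _ _ (h _ _ zx)) (h _ _ (tb _ _ _ zx xy)).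
Qed.

Definition unprime (X : Type) (u : X + X) : X :=
  match u with inl x => x | inr x => x end.

(** For [a] in [IP X] with inverse [c], this is the relation of the idempotent [c * a]. *)
Definition lower_rel (X : Type) (a : CS X) (u v : X + X) : Prop :=
  lower (cs_rel a) (unprime X u) (unprime X v).

Lemma lower_rel_equivalence (X : Type) (a : CS X) :
  equivalence _ (lower_rel X a).
Proof.
have [r t s] := cs_rel_equivalence a.
by split=> [u|u v w|u v]; [exact: r|exact: t|exact: s].
Qed.

Lemma lower_ip_ex (X : Type) (a : CS X) :
  exists e : IP X, forall u v, cs_rel e u v <-> lower_rel X a u v.
Proof.
have el := lower_rel_equivalence X a.
have mb : meets_both (cs_of el).
  have [r _ _] := el.
  by apply/meets_bothE; split=> x; exists x; apply/cs_relE; exact: r (inl x).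
by exists (MkIP mb) => u v; exact: cs_relE.
Qed.

Lemma mul_lower_ip (X : Type) (a b e : IP X) :
  (forall u v, cs_rel e u v <-> lower_rel X a u v) ->
  (forall u v, cs_rel b u v -> cs_rel a u v) -> (b * e)%g = a.
Proof.
move=> he ba; have [_ t s] := cs_rel_equivalence a.
have /meets_bothE[b1 _] := ipP b.
apply: ip_ext => x y; rewrite ip_rel_mul; split.
  move=> /prod_crossE[d Rd /he]; apply: (t).
  (* Each link of the chain, read on primed points, lies in [a]; hence [a] joins [inl x] to [inr d]
     all along. *)
  elim: Rd => {d} [c /ba //|c d _ IH /he|c d _ IH /ba]; exact: t IH.
move=> xy; have [c xc] := b1 x.
apply: prod_cross1 (xc) _; apply/he.
exact: t (s _ _ (ba _ _ xc)) xy.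
Qed.

(** On primed points [e] agrees with [a], so [e] is built from itself as it is from [a], and
    [mul_lower_ip] applies with all three elements equal to [e]. *)
Lemma lower_ip_idem (X : Type) (a e : IP X) :
  (forall u v, cs_rel e u v <-> lower_rel X a u v) -> (e * e)%g = e.
Proof.
move=> he; apply: mul_lower_ip => // u v.
by split=> /he uv; apply/he.
Qed.

Theorem proposition4 (X : Type) (a b : IP X) :
  natural_le a b <-> (forall u v : X + X, cs_rel b u v -> cs_rel a u v).
Proof.
split=> [[e [ee ->]]|ba].
  apply: ip_sub_cross => x y xy; rewrite ip_rel_mul.
  exact: prod_cross1 xy (ip_idem ee y).
have [e he] := lower_ip_ex X a.
by exists e; split; [exact: lower_ip_idem he|rewrite (mul_lower_ip X a b e)].
Qed.
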